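(* Let $a>0$. For $N>0$ and $n=0,1,2,\ldots$ let $C_n^{a,N}(x)$ be the generalized Charlier polynomials $$C_n^{a,N}(x)=\left[1+N(-1)^nC_n^{(a)}(-1)\right]C_n^{(a)}(x)-N(-1)^nC_n^{(a)}(0)\,C_n^{(a)}(x-1).$$ There is exactly one choice of coefficients $\{A_i(x)\}_{i=0}^{\infty}$, with $A_0(x)=A_0(n,a)$ independent of $x$ and of $N$ (but allowed to depend on $n$), and with $A_i(x)=A_i(a,x)$, $i\ge 1$, functions of $x$ independent of $n$ and of $N$, such that for all $N>0$ and all $n=0,1,2,\ldots$ the polynomial $y(x)=C_n^{a,N}(x)$ satisfies $$N\sum_{i=0}^{\infty}A_i(x)\Delta^iy(x)+x\Delta\nabla y(x)+(a-x)\Delta y(x)+ny(x)=0$$ for all real $x$. These coefficients are given by $$A_0(n,a)=(-1)^{n-1}C_{n-1}^{(a)}(-2),\qquad n=0,1,2,\ldots,$$ and, for $i=1,2,3,\ldots$, $$A_i(a,x)=\sum_{k=1}^i(-1)^kC_{i-k}^{(-a)}(-x+1)\left[C_k^{(a)}(-1)C_k^{(a)}(x-2)-C_k^{(a)}(-2)C_k^{(a)}(x-1)\right].$$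
   Context: For any real parameter $a$ (positive or negative) the Charlier polynomials are $$C_n^{(a)}(x):=\sum_{k=0}^n\binom{x}{k}\frac{(-a)^{n-k}}{(n-k)!},\qquad n=0,1,2,\ldots,$$ where $\binom{x}{k}=x(x-1)\cdots(x-k+1)/k!$, so that $C_n^{(a)}$ is a polynomial in $x$ and may be evaluated at any real $x$; by convention $C_{-1}^{(a)}(x)\equiv 0$. The difference operators are $\Delta f(x):=f(x+1)-f(x)$ and $\nabla f(x):=f(x)-f(x-1)$, and $\Delta^i$ is the $i$-th iterate of $\Delta$ ($\Delta^0$ is the identity). Since $y$ is a polynomial, only finitely many terms of the infinite sum are nonzero. For $a>0$, $N>0$ the polynomials $C_n^{a,N}$ are orthogonal with respect to $\langle f,g\rangle=\sum_{x=0}^{\infty}\frac{e^{-a}a^x}{x!}f(x)g(x)+Nf(0)g(0)$. *)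

(* Defs.v *)
From mathcomp Require Import all_boot all_order all_algebra.
From mathcomp Require Import all_classical all_reals all_analysis.

Set Implicit Arguments.
Unset Strict Implicit.
Unset Printing Implicit Defensive.

Import Order.TTheory GRing.Theory Num.Theory.
Import numFieldNormedType.Exports.

Local Open Scope ring_scope.

Definition rbinom (R : realType) (x : R) (k : nat) : R :=
  (\prod_(j < k) (x - j%:R)) / (k`!)%:R.

Definition charlier (R : realType) (a : R) (n : nat) (x : R) : R :=
  \sum_(k < n.+1) rbinom x k * ((- a) ^+ (n - k) / ((n - k)`!)%:R).

Definition gen_charlier (R : realType) (a N : R) (n : nat) (x : R) : R :=
  (1 + N * (-1) ^+ n * charlier a n (-1)) * charlier a n x
  - N * (-1) ^+ n * charlier a n 0 * charlier a n (x - 1).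

Definition fdiff (R : realType) (f : R -> R) (x : R) : R := f (x + 1) - f x.

Definition bdiff (R : realType) (f : R -> R) (x : R) : R := f x - f (x - 1).

(* A coefficient family is encoded as [A i n x], a priori depending on the
   order [i], the degree [n] and the point [x]: the coefficient of order 0 may
   not depend on [x], the others may not depend on [n]. *)
Definition coef_family (R : realType) (A : nat -> nat -> R -> R) : Prop :=
  (forall n x x', A 0%N n x = A 0%N n x') /\
  (forall i n n' x, (0 < i)%N -> A i n x = A i n' x).

(* [A] is bound outside the quantifier on [N], hence independent of it.
   The limit always exists: [gen_charlier a N n] is a polynomial function, so
   the terms of the series vanish from some rank on. *)
Definition solves_diff_eq (R : realType) (a : R) (A : nat -> nat -> R -> R)
    : Prop :=
  forall (N : R) (n : nat) (x : R), 0 < N ->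
    let y := gen_charlier a N n in
    N * limn (series (fun i => A i n x * iter i (@fdiff R) y x))
    + x * fdiff (bdiff y) x + (a - x) * fdiff y x + n%:R * y x = 0.

(* The value at [n = 0] comes from the convention that the Charlier polynomial
   of degree -1 is zero. *)
Definition diff_coef0 (R : realType) (a : R) (n : nat) : R :=
  if n is m.+1 then (-1) ^+ m * charlier a m (- 2) else 0.

Definition diff_coef (R : realType) (a : R) (i : nat) (x : R) : R :=
  \sum_(1 <= k < i.+1) (-1) ^+ k * charlier (- a) (i - k) (- x + 1) *
    (charlier a k (-1) * charlier a k (x - 2)
     - charlier a k (- 2) * charlier a k (x - 1)).

(* Main.v *)
Require Import Defs.
From mathcomp Require Import all_boot all_order all_algebra.
From mathcomp Require Import all_classical all_reals all_analysis.
From mathcomp Require Import ring lra.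

(** With generating function [e^(-at) (1+t)^x], the Charlier polynomials satisfy
    [Delta C_n = C_(n-1)].  Put [c = (-1)^n C_n(-1)] and [d = (-1)^n C_n(0)].
    The operator [x Delta Nabla + (a - x) Delta + n] kills [C_n] and maps
    [C_n(x-1)] to [-C_(n-1)(x-2)], so comparing powers of [N] turns the
    difference equation into the two convolution identities
    [sum_i A_i C_(n-i)(x) = - d C_(n-1)(x-2)] and
    [sum_i A_i C_(n-i)(x-1) = - c C_(n-1)(x-2)],
    the second after division by [d], which is nonzero because [a > 0].
    Their difference determines [A_0(n)], and then either one determines [A_n].
    For existence, [C^(-a)(1-x)] is the convolution inverse of [C^(a)(x-1)], so
    the given [A_i] satisfy both identities. *)

Set Implicit Arguments.
Unset Strict Implicit.
Unset Printing Implicit Defensive.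

Import Order.TTheory GRing.Theory Num.Theory.
Import numFieldNormedType.Exports.

Local Open Scope ring_scope.

(** * Convolution as multiplication of formal power series *)

Definition conv (K : comNzRingType) (f g : nat -> K) (n : nat) : K :=
  \sum_(k < n.+1) f k * g (n - k)%N.

Lemma coef_mul_trunc (K : comNzRingType) (f g : nat -> K) (m n : nat) :
  (n <= m)%N ->
  ((\poly_(i < m.+1) f i) * (\poly_(i < m.+1) g i))`_n = conv f g n.
Proof.
move=> nm; rewrite coefM; apply: eq_bigr => i _.
rewrite !coef_poly !ltnS (leq_trans _ nm) ?(leq_trans (leq_subr _ _) nm) //.
by rewrite -ltnS.
Qed.

(** Inherited from polynomial multiplication: coefficient [n] of a product depends only on
    coefficients up to [n], so truncating there loses nothing. *)
Lemma convA (K : comNzRingType) (f g h : nat -> K) (n : nat) :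
  conv (conv f g) h n = conv f (conv g h) n.
Proof.
pose t (u : nat -> K) := \poly_(i < n.+1) u i.
transitivity ((t f * t g * t h)`_n); last rewrite -mulrA.
  rewrite coefM; apply: eq_bigr => i _.
  by rewrite coef_mul_trunc -1?ltnS // coef_poly ltnS leq_subr.
rewrite coefM; apply: eq_bigr => i _.
by rewrite coef_mul_trunc ?leq_subr // coef_poly ltn_ord.
Qed.

(* The Leibniz rule for products of formal power series. *)
Lemma conv_leibniz (K : comNzRingType) (f g : nat -> K) (n : nat) :
  n.+1%:R * conv f g n.+1 =
  conv (fun k => k.+1%:R * f k.+1) g n + conv f (fun k => k.+1%:R * g k.+1) n.
Proof.
(* In each term the weight splits as [k + (n.+1 - k)]; the end term of weight 0 then drops out of
   each sum, which shifts the index. *)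
have -> : n.+1%:R * conv f g n.+1 =
    conv (fun k => k%:R * f k) g n.+1 + conv f (fun k => k%:R * g k) n.+1.
  rewrite /conv mulr_sumr -big_split; apply: eq_bigr => k _ /=.
  have kn : (k <= n.+1)%N by rewrite -ltnS.
  by rewrite -{1}(subnKC kn) natrD; ring.
congr (_ + _).
  by rewrite /conv big_ord_recl mul0r mul0r add0r; apply: eq_bigr.
rewrite /conv big_ord_recr /= subnn mul0r mulr0 addr0.
by apply: eq_bigr => k _; rewrite subSn // -ltnS.
Qed.

Section Charlier.
Variable R : realType.
Implicit Types (a b c x u v N : R) (f : nat -> R) (A B : nat -> nat -> R -> R).

(** * Recurrence, shift and addition formulas for Charlier polynomials *)

Lemma natr_fact_neq0 (n : nat) : (n`!)%:R != 0 :> R.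
Proof. by rewrite pnatr_eq0 -lt0n fact_gt0. Qed.

Lemma rbinom0 x : rbinom x 0 = 1.
Proof. by rewrite /rbinom big_ord0 fact0 divr1. Qed.

Lemma rbinom_absorb x (k : nat) :
  k.+1%:R * rbinom x k.+1 = x * rbinom (x - 1) k.
Proof.
rewrite /rbinom big_ord_recl subr0 factS natrM.
have -> : \prod_(i < k) (x - (lift ord0 i)%:R) = \prod_(j < k) (x - 1 - j%:R).
  by apply: eq_bigr => i _; rewrite lift0 -natr1; ring.
have := natr_fact_neq0 k; have : k.+1%:R != 0 :> R by rewrite pnatr_eq0.
by rewrite -natr1 => ? ?; field; apply/andP; split.
Qed.

Lemma rbinom_pascal x (k : nat) :
  rbinom (x + 1) k.+1 = rbinom x k.+1 + rbinom x k.
Proof.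
have kn0 : k.+1%:R != 0 :> R by rewrite pnatr_eq0.
apply: (mulfI kn0); rewrite rbinom_absorb addrK mulrDr.
rewrite /rbinom big_ord_recr /= factS natrM -natr1.
have := natr_fact_neq0 k; move: kn0; rewrite -natr1 => ? ?.
by field; apply/andP; split.
Qed.

Lemma charlier0 a x : charlier a 0 x = 1.
Proof. by rewrite /charlier big_ord1 rbinom0 subnn expr0 fact0 divr1 mulr1. Qed.

Lemma charlier_conv a x (n : nat) :
  charlier a n x = conv (rbinom x) (fun j => (- a) ^+ j / (j`!)%:R) n.
Proof. by []. Qed.

(** Coefficient form of the derivative in [t] of [e^(-at) (1+t)^x]. *)
Lemma charlier_rec a x (n : nat) :
  n.+1%:R * charlier a n.+1 x = x * charlier a n (x - 1) - a * charlier a n x.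
Proof.
rewrite !charlier_conv conv_leibniz /conv !mulr_sumr -sumrN.
congr (_ + _); apply: eq_bigr => k _.
  by rewrite rbinom_absorb -mulrA.
set j := (n - k)%N; rewrite factS natrM exprS.
have := natr_fact_neq0 j; have : j.+1%:R != 0 :> R by rewrite pnatr_eq0.
by move=> ? ?; field; apply/andP; split.
Qed.

(** Raising [x] by 1 multiplies the generating function by [1 + t]. *)
Lemma charlier_shift a x (n : nat) :
  charlier a n.+1 (x + 1) = charlier a n.+1 x + charlier a n x.
Proof.
rewrite /charlier big_ord_recl [in RHS]big_ord_recl !rbinom0 -addrA.
congr (_ + _); rewrite -big_split; apply: eq_bigr => k _.
by rewrite lift0 subSS rbinom_pascal /=; ring.
Qed.

(** This is the classical equation [x Delta Nabla y + (a - x) Delta y + n y = 0] with the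
    differences expanded. *)
Lemma charlier_eigen a x (n : nat) :
  a * charlier a n (x + 1) - (x + a) * charlier a n x
  + x * charlier a n (x - 1) + n%:R * charlier a n x = 0.
Proof.
case: n => [|n]; first by rewrite !charlier0; ring.
have shift := charlier_shift a (x - 1) n; rewrite subrK in shift.
rewrite charlier_rec charlier_shift shift.
by ring.
Qed.

(** Generating functions multiply by adding parameters and exponents. By the Leibniz rule both sides
    obey the same recurrence, which shifts [u] or [v]; hence the induction is uniform in both. *)
Lemma charlier_add a b u v (n : nat) :
  conv (charlier a ^~ u) (charlier b ^~ v) n = charlier (a + b) n (u + v).
Proof.
elim: n u v => [|n IH] u v; first by rewrite /conv big_ord1 !charlier0 mulr1.
have n0 : n.+1%:R != 0 :> R by rewrite pnatr_eq0.
apply: (mulfI n0); rewrite conv_leibniz charlier_rec.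
transitivity (u * conv (charlier a ^~ (u - 1)) (charlier b ^~ v) n
    + v * conv (charlier a ^~ u) (charlier b ^~ (v - 1)) n
    - (a + b) * conv (charlier a ^~ u) (charlier b ^~ v) n).
  rewrite /conv !mulr_sumr -sumrN -!big_split; apply: eq_bigr => k _ /=.
  by rewrite !charlier_rec; ring.
by rewrite !IH (addrAC u (- 1) v) (addrA u v (- 1)); ring.
Qed.

Lemma charlier00 (n : nat) : charlier 0 n 0 = (n == 0%N)%:R :> R.
Proof.
case: n => [|n]; first by rewrite charlier0.
have n0 : n.+1%:R != 0 :> R by rewrite pnatr_eq0.
by apply: (mulfI n0); rewrite charlier_rec !mul0r subr0 mulr0.
Qed.

Lemma charlier_at0_neq0 a (n : nat) : 0 < a -> charlier a n 0 != 0.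
Proof.
move=> a0; elim: n => [|n IH]; first by rewrite charlier0 oner_eq0.
apply/eqP => E; have := charlier_rec a 0 n.
rewrite E mulr0 mul0r sub0r => /esym/eqP.
by rewrite oppr_eq0 mulf_eq0 (negPf IH) (gt_eqF a0).
Qed.

(** * Reduction of the difference equation to convolution identities *)

(** The conditional matters: for [i > n] the truncated [n - i] is 0, and [charlier a 0] is 1 rather
    than 0. *)
Lemma iter_fdiff_charlier a (n i : nat) x :
  iter i (@fdiff R) (charlier a n) x =
  if (i <= n)%N then charlier a (n - i) x else 0.
Proof.
elim: i x => [|i IH] x; first by rewrite subn0.
rewrite iterS {1}/fdiff !IH; case: (ltngtP i n) => [lt_in|_|->].
- by rewrite -(subnSK lt_in) charlier_shift; ring.
- by rewrite subrr.
- by rewrite subnn !charlier0 subrr.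
Qed.

Lemma iter_fdiff_gen_charlier a N (n i : nat) x :
  iter i (@fdiff R) (gen_charlier a N n) x =
  (1 + N * (-1) ^+ n * charlier a n (-1)) * iter i (@fdiff R) (charlier a n) x
  - N * (-1) ^+ n * charlier a n 0 * iter i (@fdiff R) (charlier a n) (x - 1).
Proof.
elim: i x => [//|i IH] x.
by rewrite !iterS /fdiff !IH (addrAC x 1 (-1)); ring.
Qed.

Lemma limn_series_finite f (n : nat) :
  (forall i, (n < i)%N -> f i = 0) -> limn (series f) = \sum_(i < n.+1) f i.
Proof.
move=> f0; apply: cvg_lim => //; apply: cvg_near_cst.
exists n.+1 => // m /= nm.
rewrite /series /= (big_cat_nat (n := n.+1)) //= big_mkord.
rewrite [X in _ + X]big_nat_cond [X in _ + X]big1 ?addr0 //.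
by move=> i /andP[/andP[/f0 ->]].
Qed.

(** On [C_n(x-1)] the operator has coefficients in [x] where the eigenvalue equation at [x - 1] has
    [x - 1]; this mismatch is the right side. Its form as a difference of values also covers
    [n = 0]. *)
Lemma charlier_operator a N (n : nat) x :
  x * fdiff (bdiff (gen_charlier a N n)) x
  + (a - x) * fdiff (gen_charlier a N n) x + n%:R * gen_charlier a N n x =
  N * ((-1) ^+ n * charlier a n 0) * (charlier a n (x - 1) - charlier a n (x - 2)).
Proof.
have E1 := charlier_eigen a x n.
have E2 := charlier_eigen a (x - 1) n.
rewrite subrK (_ : x - 1 - 1 = x - 2) in E2; last by ring.
rewrite /fdiff /bdiff /gen_charlier !addrK (_ : x - 1 - 1 = x - 2); last by ring.
move: (_ ^+ n) (charlier a n (-1)) (charlier a n 0) => s p q.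
move: E1 E2; move: (charlier a n (x + 1)) (charlier a n x) (charlier a n (x - 1))
  (charlier a n (x - 2)) => y3 y2 y1 y0 E1 E2.
apply: subr0_eq; transitivity ((1 + N * s * p) * 0 - N * s * q * 0).
  by rewrite -{1}E1 -E2; ring.
by ring.
Qed.

Lemma solves_diff_eqE a A : 0 < a ->
  solves_diff_eq a A <->
  forall n x,
    \sum_(i < n.+1) A i n x * charlier a (n - i) x =
      (-1) ^+ n * charlier a n 0 * (charlier a n (x - 2) - charlier a n (x - 1)) /\
    \sum_(i < n.+1) A i n x * charlier a (n - i) (x - 1) =
      (-1) ^+ n * charlier a n (-1) * (charlier a n (x - 2) - charlier a n (x - 1)).
Proof.
move=> a0.
have limE N n x : limn (series (fun i =>
      A i n x * iter i (@fdiff R) (gen_charlier a N n) x)) =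
    (1 + N * (-1) ^+ n * charlier a n (-1))
      * (\sum_(i < n.+1) A i n x * charlier a (n - i) x)
    - N * (-1) ^+ n * charlier a n 0
      * (\sum_(i < n.+1) A i n x * charlier a (n - i) (x - 1)).
  rewrite (@limn_series_finite _ n) => [|i ni]; last first.
    by rewrite iter_fdiff_gen_charlier !iter_fdiff_charlier leqNgt ni
       !mulr0 subrr mulr0.
  under eq_bigr do rewrite iter_fdiff_gen_charlier !iter_fdiff_charlier.
  move: (charlier a n (-1)) (charlier a n 0) => p q.
  rewrite !mulr_sumr -sumrN -big_split; apply: eq_bigr => i _ /=.
  have -> : (i <= n)%N by rewrite -ltnS.
  by ring.
have eqE N n x :
    N * limn (series (fun i => A i n x * iter i (@fdiff R) (gen_charlier a N n) x))
    + x * fdiff (bdiff (gen_charlier a N n)) x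
    + (a - x) * fdiff (gen_charlier a N n) x + n%:R * gen_charlier a N n x =
    N * ((1 + N * (-1) ^+ n * charlier a n (-1))
      * (\sum_(i < n.+1) A i n x * charlier a (n - i) x)
    - N * (-1) ^+ n * charlier a n 0
      * (\sum_(i < n.+1) A i n x * charlier a (n - i) (x - 1))
    + (-1) ^+ n * charlier a n 0 * (charlier a n (x - 1) - charlier a n (x - 2))).
  rewrite limE [RHS]mulrDr [in RHS](mulrA N (_ * _)) -charlier_operator.
  by rewrite !addrA.
split=> [sol n x|sol N n x _]; last first.
  by apply: etrans (eqE N n x) _; have [-> ->] := sol n x; ring.
(* Divided by [N], the equation is affine in [N], so the values 1 and 2 yield both coefficients:
   [H1] is the constant one, [H2] the linear one. *)
have := etrans (esym (eqE 2 n x)) (sol 2 n x (ltr0Sn R 1)).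
have := etrans (esym (eqE 1 n x)) (sol 1 n x ltr01).
have d0 := charlier_at0_neq0 n a0.
have s0 : (-1) ^+ n != 0 :> R by rewrite signr_eq0.
move: d0 s0.
move: (_ ^+ n) (charlier a n (-1)) (charlier a n 0) (charlier a n (x - 1))
  (charlier a n (x - 2)) => s p q y1 y0.
move: (\sum_(i < _) _) (\sum_(i < _) _) => S2 S1 q0 s0 E1 E2.
have H1 : S1 = s * q * (y0 - y1) by lra.
split=> //; apply: (mulfI (mulf_neq0 s0 q0)).
have H2 : s * q * S2 = s * p * S1 by lra.
by rewrite H2 H1; ring.
Qed.

(** * Existence: the explicit coefficients *)

Lemma conv_charlier_shift a x f (n : nat) :
  conv f (charlier a ^~ x) n.+1 =
  conv f (charlier a ^~ (x - 1)) n.+1 + conv f (charlier a ^~ (x - 1)) n.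
Proof.
rewrite /conv big_ord_recr [in RHS]big_ord_recr /= subnn !charlier0 addrAC.
congr (_ + _); rewrite -big_split; apply: eq_bigr => k _ /=.
rewrite subSn -1?ltnS // -{1}(subrK 1 x) charlier_shift; ring.
Qed.

Definition diff_coef_kernel a x (k : nat) : R :=
  (-1) ^+ k * (charlier a k (-1) * charlier a k (x - 2)
     - charlier a k (- 2) * charlier a k (x - 1)).

(** The kernel vanishes at [k = 0], so the sum starting at 1 is a full convolution. *)
Lemma diff_coef_conv a (i : nat) x :
  diff_coef a i x =
  conv (diff_coef_kernel a x) (charlier (- a) ^~ (- x + 1)) i.
Proof.
rewrite /diff_coef /conv big_ord_recl {1}/diff_coef_kernel !charlier0.
rewrite !mulr1 subrr mulr0 mul0r add0r big_add1 big_mkord.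
by apply: eq_bigr => k _; rewrite lift0 /diff_coef_kernel mulrAC.
Qed.

Lemma diff_coef_conv_charlier a (n : nat) x :
  conv (diff_coef a ^~ x) (charlier a ^~ (x - 1)) n = diff_coef_kernel a x n.
Proof.
transitivity (conv (conv (diff_coef_kernel a x) (charlier (- a) ^~ (- x + 1)))
    (charlier a ^~ (x - 1)) n).
  by apply: eq_bigr => i _; rewrite diff_coef_conv.
rewrite convA {1}/conv big_ord_recr /= subnn charlier_add charlier0 mulr1.
(* The two Charlier factors have inverse generating functions, so only the term [k = n] survives. *)
rewrite big1 ?add0r // => k _.
rewrite charlier_add addNr (_ : - x + 1 + (x - 1) = 0); last by ring.
by rewrite charlier00 subn_eq0 leqNgt ltn_ord mulr0.
Qed.

Lemma diff_coef_ord0 a x : diff_coef a 0 x = 0.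
Proof. by rewrite /diff_coef big_geq. Qed.

Definition diff_coefs a (i n : nat) x : R :=
  if i is 0 then diff_coef0 a n else diff_coef a i x.

Lemma sum_diff_coefs a (n : nat) x f :
  \sum_(i < n.+1) diff_coefs a i n x * f (n - i)%N =
  diff_coef0 a n * f n + conv (diff_coef a ^~ x) f n.
Proof.
rewrite big_ord_recl /conv big_ord_recl /= subn0; congr (_ + _).
by rewrite diff_coef_ord0 mul0r add0r.
Qed.

Lemma diff_coefs_solve a : 0 < a -> solves_diff_eq a (diff_coefs a).
Proof.
move=> a0; apply/solves_diff_eqE => // n x.
rewrite (sum_diff_coefs _ _ _ (charlier a ^~ x)).
rewrite (sum_diff_coefs _ _ _ (charlier a ^~ (x - 1))).
case: n => [|n].
  rewrite /conv !big_ord1 diff_coef_ord0 /= !charlier0; split; ring.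
have shift y : charlier a n.+1 y = charlier a n.+1 (y - 1) + charlier a n (y - 1).
  by rewrite -charlier_shift subrK.
rewrite conv_charlier_shift !diff_coef_conv_charlier /diff_coef_kernel /=.
(* Once the values of index [n.+1] are moved to the arguments [-2] and [x - 2], both identities are
   purely algebraic. *)
rewrite (shift x) (shift 0) sub0r (shift (-1)) (shift (x - 1)).
rewrite (_ : x - 1 - 1 = x - 2); last by ring.
rewrite (_ : -1 - 1 = - 2); last by ring.
have E := shift (x - 1); rewrite (_ : x - 1 - 1 = x - 2) in E; last by ring.
by rewrite exprS; split; ring.
Qed.

(** * Uniqueness of the coefficients *)

Lemma coef_family_unique a A B : 0 < a ->
  coef_family A -> solves_diff_eq a A ->
  coef_family B -> solves_diff_eq a B -> A = B.
Proof.
move=> a0 [A0 AS] /(solves_diff_eqE _ a0) eqA [B0 BS] /(solves_diff_eqE _ a0) eqB.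
(* Strong induction pairs order [n] with degree [n]: the only new unknowns in degree [n] are
   [A_0(n)] and [A_n]. *)
suff AB n : (forall x, A 0%N n x = B 0%N n x) /\
    ((0 < n)%N -> forall m x, A n m x = B n m x).
  apply/funext => i; apply/funext => n; apply/funext => x.
  by case: i => [|i]; [apply: (AB n).1 | apply: (AB i.+1).2].
elim/ltn_ind: n => -[_|n IH].
  split=> // x; have [+ _] := eqA 0%N x; have [+ _] := eqB 0%N x.
  by rewrite !big_ord1 !charlier0 !mulr1 => -> ->.
have IH' (k : 'I_n) m x : A k.+1 m x = B k.+1 m x.
  by apply: (IH k.+1 _).2; rewrite // ltnS.
have D y x : \sum_(i < n.+2) A i n.+1 x * charlier a (n.+1 - i) y
     = \sum_(i < n.+2) B i n.+1 x * charlier a (n.+1 - i) y ->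
   (A 0%N n.+1 x - B 0%N n.+1 x) * charlier a n.+1 y
     = B n.+1 n.+1 x - A n.+1 n.+1 x.
  rewrite [in LHS]big_ord_recl [in RHS]big_ord_recl.
  rewrite [in LHS]big_ord_recr [in RHS]big_ord_recr.
  rewrite !lift0 /= subn0 subnn charlier0 !mulr1.
  under eq_bigr do rewrite [A _ _ _]IH'.
  by move: (\sum_(i < n) _) => S E; lra.
have D1 x : (A 0%N n.+1 x - B 0%N n.+1 x) * charlier a n.+1 x
     = B n.+1 n.+1 x - A n.+1 n.+1 x.
  by apply: D; rewrite (eqA _ _).1 (eqB _ _).1.
have D2 x : (A 0%N n.+1 x - B 0%N n.+1 x) * charlier a n.+1 (x - 1)
     = B n.+1 n.+1 x - A n.+1 n.+1 x.
  by apply: D; rewrite (eqA _ _).2 (eqB _ _).2.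
have E0 x : A 0%N n.+1 x = B 0%N n.+1 x.
  (* As [A_0] is constant in [x], one point suffices. At [x = 1], subtracting [D2] from [D1] leaves
     the factor [C_n(0)], which is nonzero. *)
  rewrite (A0 _ x 1) (B0 _ x 1); apply/eqP; rewrite -subr_eq0.
  have shift := charlier_shift a 0 n; rewrite add0r in shift.
  have /eqP : (A 0%N n.+1 1 - B 0%N n.+1 1) * charlier a n 0 = 0.
    by have := D1 1; rewrite -D2 subrr shift; lra.
  by rewrite mulf_eq0 (negPf (charlier_at0_neq0 n a0)) orbF.
split=> // _ m x.
rewrite (AS _ _ n.+1) // (BS _ _ n.+1) //; apply/eqP; rewrite eq_sym -subr_eq0.
by rewrite -D1 E0 subrr mul0r.
Qed.

End Charlier.

Theorem theorem1 (R : realType) (a : R) (a_gt0 : 0 < a) :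
  exists A : nat -> nat -> R -> R,
    unique (fun B => coef_family B /\ solves_diff_eq a B) A /\
    (forall (n : nat) (x : R), A 0%N n x = diff_coef0 a n) /\
    (forall (i n : nat) (x : R), (0 < i)%N -> A i n x = diff_coef a i x).
Proof.
have famA : coef_family (diff_coefs a) by split=> // -[].
have solA := diff_coefs_solve a_gt0.
exists (diff_coefs a); split; last by split=> // -[].
by split=> // B [famB solB]; apply: coef_family_unique a_gt0 _ _ _ _.
Qed.
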